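(* Let $\mathcal{T}=(V,E,\varrho)$ be a locally finite, infinite rooted tree of intermediate growth, let $\lambda>0$, and give each edge $e\in E$ the conductance $c(e)=\exp(-|e|^{\lambda})$. Let $\mathbf{X}=(X_n)_{n\ge 0}$ be the nearest-neighbour random walk on $\mathcal{T}$ with $X_0=\varrho$ and, for $n\ge 1$ and adjacent vertices $\mu,\nu$, $$\mathbb{P}[X_n=\nu \mid X_{n-1}=\mu]=\frac{c(\{\mu,\nu\})}{\sum_{\nu'\sim\mu}c(\{\mu,\nu'\})},$$ where the sum runs over all neighbours $\nu'$ of $\mu$ (parent and children). If $\lambda>\mathrm{IBN}(\mathcal{T})$, then $\mathbf{X}$ is recurrent. If $\lambda\in(0,\mathrm{IBN}(\mathcal{T}))$, then $\mathbf{X}$ is transient.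
   Context: For a rooted tree $\mathcal{T}=(V,E,\varrho)$, $|v|$ is the graph distance from $v$ to the root $\varrho$. For an edge $e$ with endpoints $e^-,e^+$ where $|e^+|=|e^-|+1$, put $|e|=|e^+|$. Let $E_n=\{x\in V: |x|=n\}$. The tree is of intermediate growth if $$0<\liminf_{n\to\infty}\frac{\log\log\#E_n}{\log n}\le\limsup_{n\to\infty}\frac{\log\log\#E_n}{\log n}<1.$$ A cutset is a set $\pi\subset E$ such that every infinite self-avoiding path from $\varrho$ to infinity has exactly one edge in $\pi$; $\Pi$ is the set of all cutsets. The intermediate branching number is $$\mathrm{IBN}(\mathcal{T})=\sup\Big\{\lambda>0:\ \inf_{\pi\in\Pi}\sum_{e\in\pi}\exp(-|e|^{\lambda})>0\Big\},$$ with the convention $\sup\emptyset=0$. *)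

(* Defs.v *)
From HB Require Import structures.
From mathcomp Require Import all_boot all_order all_algebra.
From mathcomp Require Import finmap.
From mathcomp Require Import all_classical all_reals all_analysis.

Set Implicit Arguments.
Unset Strict Implicit.
Unset Printing Implicit Defensive.

Import Order.TTheory GRing.Theory Num.Theory.
Import numFieldNormedType.Exports.

Local Open Scope classical_set_scope.
Local Open Scope ring_scope.

Record rooted_tree := RootedTree {
  vertex :> choiceType;
  root : vertex;
  adj : rel vertex;
  adj_sym : symmetric adj;
  adj_irr : irreflexive adj;
  adj_connected : forall x y, exists2 p, path adj x p & last x p = y;
  (* [cycle] holds of [:: x; y] as soon as adj x y, hence the bound 3 *)
  adj_acyclic : forall c, uniq c -> cycle adj c -> (size c < 3)%N
}.

Definition nbrs (T : rooted_tree) (x : T) : set T := [set y | adj x y].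

Definition locally_finite (T : rooted_tree) : Prop :=
  forall x : T, finite_set (nbrs x).

Definition walk_of_length (T : rooted_tree) (x y : T) (n : nat) : Prop :=
  exists p, [/\ path (@adj T) x p, last x p = y & size p = n].

Lemma walk_exists (T : rooted_tree) (x y : T) :
  exists n, `[< walk_of_length x y n >].
Proof.
have [p xp py] := adj_connected x y.
by exists (size p); apply/asboolP; exists p.
Qed.

Definition gdist (T : rooted_tree) (x y : T) : nat := ex_minn (walk_exists x y).

Definition height (T : rooted_tree) (x : T) : nat := gdist (root T) x.

Definition level (T : rooted_tree) (n : nat) : set T :=
  [set x | height x = n].

Section growth.
Context (R : realType) (T : rooted_tree).
Local Open Scope ereal_scope.

(* [lne], unlike [ln], has lne 0 = -oo, which is the value of
   log log 1 needed for the levels with a single vertex. *)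
Definition loglog_growth (n : nat) : \bar R :=
  lne (lne (#|` fset_set (@level T n)|%:R)%:E) * ((ln n%:R)^-1)%:E.

Definition intermediate_growth : Prop :=
  [/\ 0 < limn_einf loglog_growth,
      limn_einf loglog_growth <= limn_esup loglog_growth &
      limn_esup loglog_growth < 1].

End growth.

Definition edges (T : rooted_tree) : set {fset T} :=
  [set e | exists x y : T, adj x y /\ e = [fset x; y]%fset].

(* |e| = |e^+| is the larger of the heights of the two endpoints of e. *)
Definition edge_height (T : rooted_tree) (e : {fset T}) : nat :=
  (\max_(x <- e) height x)%N.

Definition root_ray (T : rooted_tree) (r : nat -> T) : Prop :=
  [/\ r 0%N = root T, forall n, adj (r n) (r n.+1) & injective r].

Definition ray_edges (T : rooted_tree) (r : nat -> T) : set {fset T} :=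
  range (fun n => [fset r n; r n.+1]%fset).

Definition cutset (T : rooted_tree) (pi : set {fset T}) : Prop :=
  pi `<=` @edges T /\
  forall r, root_ray r -> exists! e, (pi `&` ray_edges r) e.

Section conductances.
Context (R : realType) (T : rooted_tree).

Definition conductance (lambda : R) (e : {fset T}) : R :=
  expR (- ((edge_height e)%:R `^ lambda)).

Local Open Scope ereal_scope.

Definition cutset_inf (lambda : R) : \bar R :=
  ereal_inf [set \esum_(e in pi) (conductance lambda e)%:E |
             pi in @cutset T].

(* All elements of the set are positive: [maxe 0] only serves to give the
   value 0 (instead of -oo) to the supremum of the empty set. *)
Definition IBN : \bar R :=
  maxe 0 (ereal_sup [set lambda%:E | lambda in
                     [set lambda : R | (0 < lambda)%R /\ 0 < cutset_inf lambda]]).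

End conductances.

Section walks.
Context (R : realType) (T : rooted_tree).

Definition step_prob (c : {fset T} -> R) (x y : T) : R :=
  if adj x y then
    c [fset x; y]%fset / \sum_(z \in nbrs x) c [fset x; z]%fset
  else 0.

Context d (Omega : measurableType d) (P : probability Omega R).
Implicit Types X : nat -> Omega -> T.

Definition history X (x : nat -> T) (n : nat) : set Omega :=
  [set w | forall i, (i <= n)%N -> X i w = x i].

(* The Markov property is in product form, so that no conditioning on
   null events is needed.  Measurability is with respect to the discrete
   sigma-algebra: the vertex set of a locally finite tree is countable. *)
Definition random_walk (c : {fset T} -> R) X : Prop :=
  [/\ forall n x, measurable (X n @^-1` [set x]),
      P (X 0%N @^-1` [set root T]) = 1%E &
      forall (x : nat -> T) n,
        P (history X x n.+1) =
        ((step_prob c (x n) (x n.+1))%:E * P (history X x n))%E].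

Definition root_infinitely_often X : set Omega :=
  [set w | forall N, exists2 n, (N <= n)%N & X n w = root T].

Definition recurrent X : Prop := P (root_infinitely_often X) = 1%E.

Definition transient X : Prop := P (root_infinitely_often X) = 0%E.

End walks.

(* Main.v *)
Require Import Defs.
From mathcomp Require Import all_boot all_order all_algebra.
From mathcomp Require Import finmap.
From mathcomp Require Import all_classical all_reals all_analysis.
From mathcomp Require Import ring lra zify.

Import Defs.

Set Implicit Arguments.
Unset Strict Implicit.
Unset Printing Implicit Defensive.

Import Order.TTheory GRing.Theory Num.Theory.
Import numFieldNormedType.Exports.

Local Open Scope classical_set_scope.
Local Open Scope ring_scope.

(** Write [c e = exp (- |e| ^ lambda)] for the conductances.

    Recurrence.  If [lambda > IBN] then the cutsets have sums [\esum_pi c]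
    arbitrarily close to 0.  The probability [escape_prob x] of never being at
    the root after leaving [x], set to 0 at the root, is harmonic off the root
    ([voltage]), so the current [c (x y) (voltage y - voltage x)] is a flow
    with at most [c e] through each edge [e].  What it brings to the root is at
    most the sum over any cutset ([flow_le_cut]: otherwise one could follow the
    excess of flow along a ray that avoids the cutset), hence it is 0.  Then the
    escape probability vanishes at the root, by harmonicity everywhere
    ([no_escape]), and the walk returns almost surely after any time
    ([recurrent_of_no_escape]).

    Transience.  If [lambda < IBN], there is [mu > lambda] for which all sums
    of [exp (- |e| ^ mu)] over cutsets are at least some [delta > 0].  The
    values of the cheapest cuts of bounded depth, computed by a recursion on
    the depth ([greedy_cut]), decrease to those of a flow [theta] bounded by
    [exp (- |e| ^ mu)] and whose total at the root is at least [delta]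
    ([cvg_cut_value]); at each vertex at least as much leaves as enters
    ([limit_flow_out]).  On a tree, a flow determines a voltage: the drop
    across [e] is [theta e / c e <= exp (|e| ^ lambda - |e| ^ mu)].  These
    bounds are summable in [|e|] ([stretched_exp_summable]), so the voltage is
    bounded along all rays.  Up to a constant it is a non-negative
    superharmonic function with a strict loss at the root, which bounds the
    expected number of visits to the root ([sum_return_prob]); the
    Borel-Cantelli lemma concludes. *)

(** * Rooted trees: parents, children and rays *)

Section tree.
Context (T : rooted_tree).
Local Open Scope nat_scope.
Implicit Types x y z u v : T.

Lemma height_path p : path (@adj T) (root T) p ->
  height (last (root T) p) <= size p.
Proof.
move=> rp; rewrite /height /gdist; case: ex_minnP => n _; apply.
by apply/asboolP; exists p.
Qed.

Lemma geodesic x : exists p,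
  [/\ path (@adj T) (root T) p, last (root T) p = x & size p = height x].
Proof.
by rewrite /height /gdist; case: ex_minnP => n /asboolP.
Qed.

Lemma height_root : height (root T) = 0.
Proof. by apply/eqP; rewrite -leqn0 (@height_path [::]). Qed.

Lemma height_eq0 x : height x = 0 -> x = root T.
Proof.
move=> x0; have [p [_ px]] := geodesic x; rewrite x0 => /size0nil p0.
by rewrite -px p0.
Qed.

Lemma height_adj x y : adj x y -> height y <= (height x).+1.
Proof.
move=> xy; have [p [rp px <-]] := geodesic x.
have := @height_path (rcons p y); rewrite last_rcons size_rcons; apply.
by rewrite rcons_path rp px.
Qed.

Lemma parent_exists x : x != root T ->
  exists y, adj x y /\ height x = (height y).+1.
Proof.
have [p [rp px sp]] := geodesic x; case/lastP: p => [|p y] in rp px sp *.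
  by rewrite -px eqxx.
move: rp px sp; rewrite rcons_path last_rcons size_rcons => /andP[rp pyx] yx sp _.
move: pyx; rewrite {y}yx => pyx; exists (last (root T) p).
split; first by rewrite adj_sym.
by apply/eqP; rewrite eqn_leq height_adj// -sp ltnS height_path.
Qed.

(** Two vertices of one level are joined by a simple path through lower
    levels: climb from both until the ancestors agree.  Closing such a path
    up is what acyclicity forbids. *)
Lemma path_below n x y : height x = n -> height y = n -> x != y ->
  exists p, [/\ path (@adj T) x (rcons p y), uniq (x :: rcons p y),
                {in p, forall z, height z < n} & 0 < size p].
Proof.
elim: n x y => [|n IHn] x y hx hy xy.
  by move: xy; rewrite (height_eq0 hx) (height_eq0 hy) eqxx.
have neq_height u v : height u != height v -> u != v.
  by apply: contra_neq => ->.
have up u : height u = n.+1 -> exists2 v, adj u v & height v = n.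
  move=> hu; have [|v [uv]] := @parent_exists u.
    by apply: neq_height; rewrite hu height_root.
  by rewrite hu => -[hv]; exists v.
have [x' xx' hx'] := up x hx; have [y' yy' hy'] := up y hy.
have [x'y'|x'y'] := eqVneq x' y'.
  exists [:: x'] => /=; rewrite xx' x'y' adj_sym yy'; split => //.
    rewrite !inE negb_or xy -x'y' !andbT neq_height ?hx ?hx'//=; last lia.
    by rewrite neq_height// hy hx'; lia.
  by move=> z; rewrite inE => /eqP ->; rewrite hy'.
have [p [x'p up' hp _]] := IHn _ _ hx' hy' x'y'.
have hq z : z \in x' :: rcons p y' -> height z < n.+1.
  rewrite inE mem_rcons inE => /or3P[/eqP->|/eqP->|/hp]; rewrite ?hx' ?hy'//.
  by lia.
exists (x' :: rcons p y'); split => //.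
  by rewrite /= xx' rcons_path x'p last_rcons adj_sym yy'.
rewrite cons_uniq mem_rcons in_cons negb_or xy rcons_uniq up' andbT.
by apply/andP; split; apply/negP => /hq; rewrite ?hx ?hy ltnn.
Qed.

Lemma adj_height_neq x y : adj x y -> height x != height y.
Proof.
move=> xy; apply/eqP => hxy.
have neq_xy : x != y by apply: contraTN xy => /eqP ->; rewrite adj_irr.
have [p [xp up _ p0]] := path_below hxy erefl neq_xy.
have := adj_acyclic up; rewrite /= size_rcons rcons_path xp last_rcons.
by rewrite adj_sym xy => /(_ isT); lia.
Qed.

(** Two lower neighbours would close a cycle through [x]. *)
Lemma parent_unique x y z : adj x y -> adj x z ->
  height x = (height y).+1 -> height x = (height z).+1 -> y = z.
Proof.
move=> xy xz hy hz; apply/eqP/negPn/negP => yz.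
have [|p [yp up hp p0]] := path_below (n := height y) erefl _ yz; first lia.
have x_notin : x \notin y :: rcons p z.
  rewrite in_cons mem_rcons in_cons !negb_or; apply/and3P; split.
  - by apply/eqP => e; move: hy; rewrite -e; lia.
  - by apply/eqP => e; move: hz; rewrite -e; lia.
  - by apply/negP => /hp; lia.
have := @adj_acyclic T (x :: y :: rcons p z).
rewrite cons_uniq x_notin up => /(_ isT).
by rewrite /= xy rcons_path yp last_rcons adj_sym xz size_rcons => /(_ isT); lia.
Qed.

(** The default value makes the root its own parent. *)
Definition parent x : T := xget x [set y | adj x y /\ height x = (height y).+1].

Lemma parentP x : x != root T ->
  adj x (parent x) /\ height x = (height (parent x)).+1.
Proof.
move=> /parent_exists[y yP]; rewrite /parent.
by case: xgetP => [z -> //|/(_ y)]; case.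
Qed.

Lemma parent_eq x y : adj x y -> height x = (height y).+1 -> parent x = y.
Proof.
move=> xy hxy; have [|xp hp] := @parentP x.
  by apply/eqP => e; move: hxy; rewrite e height_root.
exact: parent_unique hp hxy.
Qed.

Lemma parent_root : parent (root T) = root T.
Proof. by rewrite /parent; case: xgetP => // y _ /= [_]; rewrite height_root. Qed.

Lemma adjP x y : adj x y ->
  (y != root T /\ parent y = x) \/ (x != root T /\ parent x = y).
Proof.
have neq_root u v : height u = (height v).+1 -> u != root T.
  by move=> huv; apply/eqP => e; move: huv; rewrite e height_root.
move=> xy; have yx : adj y x by rewrite adj_sym.
have := height_adj xy; have := height_adj yx; have := adj_height_neq xy.
rewrite neq_ltn => /orP[lt_xy _ le_yx|lt_yx le_xy _]; [left|right].
  have e : height y = (height x).+1 by lia.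
  by rewrite (neq_root y x)// (parent_eq yx e).
have e : height x = (height y).+1 by lia.
by rewrite (neq_root x y)// (parent_eq xy e).
Qed.

Definition up_edge x : {fset T} := [fset parent x; x]%fset.

Lemma edge_height_up x : edge_height (up_edge x) = height x.
Proof.
have [->|/parentP[xp hx]] := eqVneq x (root T).
  by rewrite /edge_height /up_edge parent_root fsetUid big_seq_fset1.
rewrite /edge_height /up_edge.
rewrite big_fsetU1 ?big_seq_fset1 /=; first by apply/maxn_idPr; rewrite hx.
by rewrite inE; apply: contraTN xp => /eqP ->; rewrite adj_irr.
Qed.

Lemma up_edge_edges x : x != root T -> edges (up_edge x).
Proof. by move=> /parentP[xp _]; exists (parent x), x; rewrite adj_sym. Qed.

Lemma up_edge_inj x y : x != root T -> y != root T ->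
  up_edge x = up_edge y -> x = y.
Proof.
move=> x0 y0 exy.
have hxy : height x = height y.
  by rewrite -edge_height_up// exy edge_height_up.
have : x \in up_edge y by rewrite -exy !inE eqxx orbT.
rewrite !inE => /orP[/eqP xp|/eqP//].
by have [_] := parentP y0; rewrite -xp hxy; lia.
Qed.

Definition children x : {fset T} :=
  fset_set [set y | y != root T /\ parent y = x].

Definition descendants x : set T := [set z | exists k, iter k parent z = x].

Lemma descendants_refl x : descendants x x.
Proof. by exists 0. Qed.

Lemma height_iter_parent k x : height (iter k parent x) = height x - k.
Proof.
elim: k => [|k IHk]; first by rewrite subn0.
rewrite iterS; have [e|/parentP[_]] := eqVneq (iter k parent x) (root T);
  last by rewrite IHk => /=; lia.
by move: IHk; rewrite e parent_root height_root subnS => <-.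
Qed.

(** After a step to a child, the only way back towards the root is the vertex
    just left, which injectivity forbids. *)
Lemma ray_parent (r : nat -> T) : root_ray r ->
  forall n, r n.+1 != root T /\ parent (r n.+1) = r n.
Proof.
move=> [r0 radj rinj]; elim=> [|n [rn0 IHn]].
  have [//|[]] := adjP (radj 0).
  by rewrite r0 eqxx.
have [//|[_ e]] := adjP (radj n.+1).
by have := rinj n n.+2; rewrite -e -IHn => /(_ erefl); lia.
Qed.

Lemma ray_iter_parent (r : nat -> T) : root_ray r ->
  forall k n, iter k parent (r (n + k)) = r n.
Proof.
move=> rr; elim=> [|k IHk] n; first by rewrite addn0.
by rewrite addnS iterSr (ray_parent rr _).2 IHk.
Qed.

Lemma ray_height (r : nat -> T) : root_ray r -> forall n, height (r n) = n.
Proof.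
move=> rr; elim=> [|n IHn]; first by case: rr => -> _ _; rewrite height_root.
have [rn0 rp] := ray_parent rr n.
by have [_ ->] := parentP rn0; rewrite rp IHn.
Qed.

Hypothesis T_lf : locally_finite T.

Lemma mem_children x y : (y \in children x) = (y != root T) && (parent y == x).
Proof.
rewrite in_fset_set.
  by apply/idP/idP => [|/andP[y0 /eqP yx]]; rewrite inE//= => -[-> ->]/=.
apply: sub_finite_set (T_lf x) => z [/parentP[zp _] <-].
by rewrite /nbrs /= adj_sym.
Qed.

Lemma mem_neighbours x y : (y \in fset_set (nbrs x)) = adj x y.
Proof. by rewrite in_fset_set//; apply/idP/idP; rewrite inE. Qed.

Lemma sum_neighbours (R : zmodType) x (F : T -> R) :
  (\sum_(y <- fset_set (nbrs x)) F y =
   (if x == root T then 0 else F (parent x)) + \sum_(y <- children x) F y)%R.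
Proof.
rewrite -fsbig_finite//.
have nbrsE : nbrs x = (if x == root T then set0 else [set parent x]) `|`
                      [set` children x].
  apply/seteqP; split=> y /=.
    move=> /adjP[[y0 yp]|[x0 xp]]; [right|left].
      by rewrite mem_children y0 yp eqxx.
    by rewrite (negbTE x0) /= xp.
  case; last first.
    by rewrite mem_children /nbrs /= => /andP[/parentP[yp _] /eqP<-]; rewrite adj_sym.
  by case: eqVneq => // /parentP[xp _] ->.
rewrite nbrsE fsbigU /=.
- congr (_ + _)%R.
    by case: ifP; rewrite ?fsbig_set0 ?fsbig_set1.
  by rewrite -fsbig_seq// fset_uniq.
- by case: ifP.
- exact: finite_fset.
- move=> y [] /=; case: eqVneq => //= x0 ->.
  rewrite mem_children => /andP[p0 /eqP pp].
  have [_ h1] := parentP x0; have [_ h2] := parentP p0.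
  by move: h1; rewrite h2 pp; lia.
Qed.

End tree.

(** * The transition operator and the Markov property *)

Section averaging.
Context (R : realType) (T : rooted_tree).
Hypothesis T_lf : locally_finite T.
Hypothesis T_infinite : infinite_set [set: T].
Variable c : {fset T} -> R.
Hypothesis c_gt0 : forall e, 0 < c e.
Implicit Types (x y : T) (f g : T -> R).

(** The transition operator of the walk. *)
Definition average f x : R :=
  \sum_(y <- fset_set (nbrs x)) step_prob c x y * f y.

Definition total_conductance x : R :=
  \sum_(y <- fset_set (nbrs x)) c [fset x; y]%fset.

Lemma nbrs_neq0 x : exists y, adj x y.
Proof.
apply: contrapT => xN; apply: T_infinite.
apply: (@sub_finite_set _ _ [set x]) => // y _ /=.
have [[|z p] /=] := adj_connected x y; first by [].
by move=> /andP[xz _]; case: xN; exists z.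
Qed.

Lemma total_conductance_gt0 x : 0 < total_conductance x.
Proof.
have [y xy] := nbrs_neq0 x.
have ymem : y \in fset_set (nbrs x) by rewrite mem_neighbours.
rewrite /total_conductance (big_fsetD1 y)//= ltr_pwDl// sumr_ge0// => z _.
exact: ltW.
Qed.

Lemma step_prob_ge0 x y : 0 <= step_prob c x y.
Proof.
rewrite /step_prob; case: ifP => // _; rewrite divr_ge0 ?(ltW (c_gt0 _))//.
by rewrite fsbig_finite//; exact/ltW/total_conductance_gt0.
Qed.

Lemma averageE f x : average f x =
  (\sum_(y <- fset_set (nbrs x)) c [fset x; y]%fset * f y) /
  total_conductance x.
Proof.
rewrite mulr_suml; apply: eq_big_seq => y; rewrite mem_neighbours// => xy.
by rewrite /step_prob xy fsbig_finite//= mulrAC.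
Qed.

Lemma average_cst a x : average (fun=> a) x = a.
Proof.
by rewrite averageE -mulr_suml mulrAC mulfV ?mul1r// gt_eqF// total_conductance_gt0.
Qed.

Lemma ler_average f g x : (forall y, f y <= g y) -> average f x <= average g x.
Proof. by move=> fg; apply: ler_sum => y _; rewrite ler_wpM2l ?step_prob_ge0. Qed.

Lemma average_ge0 f x : (forall y, 0 <= f y) -> 0 <= average f x.
Proof. by move=> f0; rewrite -[leLHS](average_cst 0 x) ler_average. Qed.

Lemma average_sum n (f : nat -> T -> R) x :
  average (fun y => \sum_(i < n) f i y) x = \sum_(i < n) average (f i) x.
Proof.
by rewrite exchange_big; apply: eq_bigr => y _; rewrite mulr_sumr.
Qed.

Lemma cvg_average (f : nat -> T -> R) g x :
  (forall y, f n y @[n --> \oo] --> g y) ->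
  average (f n) x @[n --> \oo] --> average g x.
Proof.
move=> fg; apply: cvg_big => [z|y _]; first exact: add_continuous.
by apply: cvgM; [exact: cvg_cst|exact: fg].
Qed.

(** For a voltage [f], the defect of the mean-value property at [x] is, up to
    the factor [total_conductance x], the net current that leaves [x]; this
    turns superharmonicity into a balance of currents. *)
Lemma average_defect f x : total_conductance x * (f x - average f x) =
  \sum_(y <- fset_set (nbrs x)) c [fset x; y]%fset * (f x - f y).
Proof.
rewrite mulrBr averageE [_ * (_ / _)]mulrC divfK; last first.
  by rewrite gt_eqF// total_conductance_gt0.
by rewrite mulr_suml -sumrB; apply: eq_bigr => y _; rewrite mulrBr.
Qed.

(** The probability, computed from the transition operator alone, that the walk
    started from [x] is in the successive sets of [Bs] at times 1, 2, and so
    on. *)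
Fixpoint visit_prob (Bs : seq (set T)) x : R :=
  if Bs is B :: Bs' then average (fun y => \1_B y * visit_prob Bs' y) x else 1.

End averaging.

Section markov.
Context (R : realType) (T : rooted_tree).
Hypothesis T_lf : locally_finite T.
Hypothesis T_infinite : infinite_set [set: T].
Variable c : {fset T} -> R.
Hypothesis c_gt0 : forall e, 0 < c e.
Context d (Omega : measurableType d) (P : probability Omega R).
Variable X : nat -> Omega -> T.
Hypothesis X_walk : random_walk P c X.

Fixpoint visits n (Bs : seq (set T)) : set Omega :=
  if Bs is B :: Bs' then X n.+1 @^-1` B `&` visits n.+1 Bs' else setT.

(** Singletons are testable by the definition of the walk, and the arguments
    below only test it against them, their complements and the whole vertex
    set. *)
Definition testable (B : set T) := forall n, measurable (X n @^-1` B).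

Lemma measurable_visits n Bs : {in Bs, forall B, testable B} ->
  measurable (visits n Bs).
Proof.
elim: Bs n => [|B Bs IHBs] n testBs /=; first exact: measurableT.
apply: measurableI; first by apply: testBs; rewrite mem_head.
by apply: IHBs => C CBs; apply: testBs; rewrite in_cons CBs orbT.
Qed.

Lemma testable1 x : testable [set x].
Proof. by case: X_walk => mX _ _ n; exact: mX. Qed.

Lemma testableC B : testable B -> testable (~` B).
Proof. by move=> mB n; rewrite preimage_setC; exact: measurableC (mB n). Qed.

Lemma testableT : testable setT.
Proof. by move=> n; rewrite preimage_setT; apply: measurableT. Qed.

Lemma measurable_history x n : measurable (history X x n).
Proof.
have -> : history X x n = \bigcap_(i in `I_n.+1) (X i @^-1` [set x i]).
  by apply/seteqP; split=> w /= xw i ilen; exact: (xw i ilen).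
by apply: fin_bigcap_measurable => // i _; apply: testable1.
Qed.

Lemma history_step x n y :
  P (history X x n `&` X n.+1 @^-1` [set y]) =
  ((step_prob c (x n) y)%:E * P (history X x n))%E.
Proof.
case: X_walk => _ _ walk.
pose x' i := if (i <= n)%N then x i else y.
have x'E : history X x' n = history X x n.
  by apply/seteqP; split=> w xw i ilen; have := xw i ilen; rewrite /x' ilen.
have := walk x' n; rewrite x'E /x' leqnn ltnn => <-; congr (P _).
apply/seteqP; split=> w.
  move=> [xw yw] i; rewrite leq_eqVlt ltnS => /orP[/eqP->|ilen].
    by rewrite ltnn.
  by rewrite ilen; apply: xw.
move=> xw; split=> [i ilen|]; first by have := xw i; rewrite ilen leqW//; apply.
by have := xw n.+1; rewrite leqnn ltnn /=; apply.
Qed.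

(** A step leads almost surely to a neighbour, because the transition
    probabilities to the neighbours add up to 1. *)
Lemma history_split x n (E : set Omega) : measurable E ->
  P (history X x n `&` E) =
  (\sum_(y <- fset_set (nbrs (x n)))
     P (history X x n `&` X n.+1 @^-1` [set y] `&` E))%E.
Proof.
move=> mE; set H := history X x n.
have mH : measurable H by exact: measurable_history.
pose A y := H `&` X n.+1 @^-1` [set y].
have mA y : measurable (A y) by apply: measurableI => //; apply: testable1.
have trivA (F : set Omega) : trivIset setT (fun y => A y `&` F).
  by move=> y z _ _ [w [[[_ <-] _] [[_ <-] _]]].
pose U := \big[setU/set0]_(y <- fset_set (nbrs (x n))) A y.
have mU : measurable U by apply: bigsetU_measurable.
have PU F : measurable F -> P (U `&` F) =
    (\sum_(y <- fset_set (nbrs (x n))) P (A y `&` F))%E.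
  move=> mF; rewrite big_distrl/= measure_fbigsetU//.
    by move=> y _; apply: measurableI.
  exact: sub_trivIset (trivA F).
have PHfin : P H \is a fin_num by exact: fin_num_measure.
have PHU : P U = P H.
  rewrite -[in LHS](setIT U) PU//.
  under eq_bigr do rewrite setIT history_step -(fineK PHfin) -EFinM.
  rewrite sumEFin -mulr_suml.
  rewrite -[X in (X * _)%:E](_ : average c (fun=> 1) (x n) = _).
    by rewrite average_cst// mul1r fineK.
  by apply: eq_bigr => y _; rewrite mulr1.
have UH : U `<=` H.
  by rewrite /U -bigcup_seq => w [y _ []].
have P0 : P (H `\` U) = 0%E.
  rewrite measureD//; last by rewrite ltey_eq PHfin.
  by rewrite setIidr// [X in (_ - X)%E]PHU subee.
rewrite -PU//; apply/eqP; rewrite eq_le; apply/andP; split; last first.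
  by apply: le_measure; rewrite ?inE; [exact: measurableI..|exact: setSI].
have -> : H `&` E = (U `&` E) `|` ((H `\` U) `&` E).
  by rewrite -setIUl setDUK.
rewrite measureU0//; [exact: measurableI| | ].
  by apply: measurableI => //; apply: measurableD.
apply: (subset_measure0 _ _ _ P0); last exact: subIsetl.
  by apply: measurableI => //; apply: measurableD.
exact: measurableD.
Qed.

(** The Markov property, by induction on [Bs] for all histories at once: a
    history followed by a step to a given neighbour is again a history. *)
Lemma prob_visits x n Bs : {in Bs, forall B, testable B} ->
  P (history X x n `&` visits n Bs) =
  ((visit_prob c Bs (x n))%:E * P (history X x n))%E.
Proof.
elim: Bs x n => [|B Bs IHBs] x n testBs; first by rewrite setIT mul1e.
have testBs' : {in Bs, forall C, testable C}.
  by move=> C CBs; apply: testBs; rewrite in_cons CBs orbT.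
have PHfin : P (history X x n) \is a fin_num.
  by apply: fin_num_measure; apply: measurable_history.
rewrite history_split; last exact: measurable_visits.
rewrite -(fineK PHfin) -EFinM mulr_suml -sumEFin; apply: eq_bigr => y _.
pose x' i := if (i <= n)%N then x i else y.
have x'E : history X x' n.+1 = history X x n `&` X n.+1 @^-1` [set y].
  apply/seteqP; split=> w.
    move=> xw; split=> [i ilen|].
      by have := xw i; rewrite /x' ilen leqW//; apply.
    by have := xw n.+1; rewrite /x' leqnn ltnn /=; apply.
  move=> [xw yw] i; rewrite leq_eqVlt ltnS /x' => /orP[/eqP->|ilen].
    by rewrite ltnn.
  by rewrite ilen; apply: xw.
rewrite indicE; have [yB|yNB] := boolP (y \in B).
  rewrite [visits n _]/= setIA -(setIA (history _ _ _)).
  rewrite (setIidl (B := X n.+1 @^-1` B)); last first.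
    by move=> w /= ->; rewrite inE in yB.
  rewrite -x'E IHBs// x'E history_step -(fineK PHfin) /x' ltnn mul1r.
  by rewrite -!EFinM mulrA [visit_prob _ _ _ * _]mulrC.
rewrite mul0r mulr0 mul0r.
rewrite [X in P X](_ : _ = set0) ?measure0//.
apply/seteqP; split=> // w [[_ wy] [wB _]]; move: yNB.
by rewrite notin_setE; apply; rewrite -[y]wy.
Qed.

Lemma prob_visits0 Bs : {in Bs, forall B, testable B} ->
  P (visits 0 Bs) = (visit_prob c Bs (root T))%:E.
Proof.
case: X_walk => _ X0 _ testBs; have mV := measurable_visits 0 testBs.
have H0 : history X (fun=> root T) 0 = X 0%N @^-1` [set root T].
  apply/seteqP; split=> w; first by apply.
  by move=> w0 i; rewrite leqn0 => /eqP ->.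
have PH0 : P (~` history X (fun=> root T) 0) = 0%E.
  by rewrite probability_setC ?H0 ?X0 ?subee//; apply: testable1.
have := prob_visits (fun=> root T) 0 testBs.
rewrite H0 X0 mule1 => <-; rewrite -H0.
rewrite (measureDI P mV (measurable_history (fun=> root T) 0)) setIC.
rewrite [X in (X + _)%E](_ : _ = 0%E) ?add0e//.
apply: subset_measure0 PH0.
- by apply: measurableD => //; apply: measurable_history.
- by apply: measurableC; apply: measurable_history.
- by move=> w [].
Qed.

End markov.

(** * Flows and cutsets *)

Section flow_cut.
Context (R : realType) (T : rooted_tree).
Hypothesis T_lf : locally_finite T.
Implicit Types x y z : T.

Lemma sum_children_descendants x z :
  \sum_(y <- children x) \1_(descendants y) z <= \1_(descendants x) z :> R.
Proof.
have [[y [ychild [k zy]]]|noy] :=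
    pselect (exists y, y \in children x /\ descendants y z); last first.
  rewrite big1_seq ?indic_ge0// => y /andP[_ ychild].
  by rewrite indicE memNset// => yz; apply: noy; exists y.
have [y0 /eqP yx] := andP (etrans (esym (mem_children T_lf x y)) ychild).
rewrite (big_fsetD1 y)//= big1_seq ?addr0; last first.
  move=> y' /andP[_]; rewrite !inE => /andP[y'y].
  rewrite mem_children// => /andP[y'0 /eqP y'x].
  rewrite indicE memNset// => -[k' zy']; move: y'y; apply/negP/negPn/eqP.
  have [[_ hy] [_ hy']] := (parentP y0, parentP y'0).
  have [] := (height_iter_parent k z, height_iter_parent k' z).
  rewrite zy zy' hy hy' yx y'x => hk hk'.
  by rewrite -zy -zy'; congr (iter _ _ _); lia.
by rewrite !indicE !mem_set// => [|]; [exists k.+1; rewrite iterS zy|exists k].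
Qed.

Lemma le_esum_subset (I : choiceType) (A B : set I) (a : I -> \bar R) :
  A `<=` B -> (\esum_(i in A) a i <= \esum_(i in B) a i)%E.
Proof.
move=> AB; apply: ge_ereal_sup => _ [F [finF FA] <-]; apply: ereal_sup_ubound.
by exists F => //; split => //; apply: subset_trans AB.
Qed.

(** The easy half of max-flow min-cut, on an infinite tree and for cutsets of
    any cardinality.  If a flow exceeded the capacity of a cutset, then from
    the root down one could always choose a child whose flow exceeds the
    capacity that the cutset has at or below that child; such a vertex is not
    cut, so the chosen ray would avoid the cutset. *)
Lemma flow_le_cut (c : {fset T} -> R) (theta : T -> R) (pi : set {fset T}) :
  (forall e, 0 <= c e) -> (forall x, theta x <= c (up_edge x)) ->
  (forall x, x != root T -> theta x <= \sum_(y <- children x) theta y) ->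
  cutset pi ->
  ((\sum_(y <- children (root T)) theta y)%:E <= \esum_(e in pi) (c e)%:E)%E.
Proof.
move=> c0 theta_cap theta_out [piE pi_ray].
rewrite leNgt; apply/negP => too_small.
pose A := [set z : T | z != root T /\ pi (up_edge z)].
pose below y := \esum_(z in A) (\1_(descendants y) z * c (up_edge z))%:E.
pose big_flow y := (below y < (theta y)%:E)%E.
have term_ge0 y z : (0 <= (\1_(descendants y) z * c (up_edge z))%:E)%E.
  by rewrite lee_fin mulr_ge0 ?indic_ge0.
have below_children x : (\sum_(y <- children x) below y <= below x)%E.
  rewrite /below -esum_sum; last by move=> z y _ _; exact: term_ge0.
  apply: le_esum => z _; rewrite sumEFin lee_fin -mulr_suml ler_wpM2r//.
  exact: sum_children_descendants.
have below_root : (below (root T) <= \esum_(e in pi) (c e)%:E)%E.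
  apply: (@le_trans _ _ (\esum_(e in (@up_edge T) @` A) (c e)%:E)).
    rewrite esum_image; last first.
      move=> y z; rewrite !inE => -[y0 _] [z0 _]; exact: up_edge_inj.
    apply: le_esum => z _; rewrite lee_fin ler_piMl// indicE lern1 leq_b1.
  by apply: le_esum_subset => _ [z [_ ze] <-].
have descend x : (below x < (\sum_(y <- children x) theta y)%:E)%E ->
    exists y, y \in children x /\ big_flow y.
  move=> lt_x; apply: contrapT => noy.
  have := le_lt_trans (below_children x) lt_x; rewrite ltNge => /negP; apply.
  rewrite -sumEFin big_seq [leRHS]big_seq; apply: lee_sum => y ychild.
  by rewrite leNgt; apply/negP => ybig; apply: noy; exists y.
have uncut y : y != root T -> big_flow y -> ~ pi (up_edge y).
  move=> y0; rewrite /big_flow ltNge => /negP ybig yA; apply: ybig.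
  apply: (@le_trans _ _ (c (up_edge y))%:E); first by rewrite lee_fin.
  apply: esum_ge; exists [set y].
    by split; [exact: finite_set1|move=> _ ->].
  rewrite fsbig_set1 indicE mem_set ?mul1r//; exact: descendants_refl.
have [y0 [y0child y0big]] : exists y, y \in children (root T) /\ big_flow y.
  by apply: descend; exact: le_lt_trans too_small.
have step y : exists z,
    y != root T -> big_flow y -> z \in children y /\ big_flow z.
  have [yok|yN] := pselect (y != root T /\ big_flow y); last first.
    by exists y => r0 yb; case: yN.
  case: yok => yr ybig.
  have [|z zP] := descend y; last by exists z.
  by apply: lt_le_trans ybig _; rewrite lee_fin theta_out.
have [next nextP] := choice step.
pose r n := if n is n'.+1 then iter n' next y0 else root T.
have rP n : [/\ r n.+1 != root T, parent (r n.+1) = r n & big_flow (r n.+1)].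
  elim: n => [|n [rn0 rp rbig]] /=.
    by move: y0child; rewrite mem_children// => /andP[-> /eqP ->].
  have [] := nextP _ rn0 rbig; rewrite mem_children// => /andP[z0 /eqP zp] zbig.
  by split.
have rheight n : height (r n) = n.
  elim: n => [|n IHn]; first exact: height_root.
  by have [rn0 rp _] := rP n; have [_ ->] := parentP rn0; rewrite rp IHn.
have rray : root_ray r.
  split=> // [n|m n rmn]; last by rewrite -(rheight m) rmn rheight.
  by have [rn0 rp _] := rP n; have [+ _] := parentP rn0; rewrite rp adj_sym.
have [e [[pie [n _ ne]] _]] := pi_ray r rray.
have [rn0 rp rbig] := rP n; apply: (uncut _ rn0 rbig).
by rewrite /up_edge rp ne.
Qed.

End flow_cut.

(** * Recurrence *)

Section recurrence.
Context (R : realType) (T : rooted_tree).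
Hypothesis T_lf : locally_finite T.
Hypothesis T_infinite : infinite_set [set: T].
Variable c : {fset T} -> R.
Hypothesis c_gt0 : forall e, 0 < c e.
Implicit Types (x y : T).

Local Notation off_root := (~` [set root T]).

Definition avoid_prob m x : R := visit_prob c (nseq m off_root) x.

Lemma avoid_probS m x :
  avoid_prob m.+1 x = average c (fun y => \1_off_root y * avoid_prob m y) x.
Proof. by []. Qed.

Lemma avoid_prob_ge0 m x : 0 <= avoid_prob m x.
Proof.
elim: m x => [|m IHm] x; first exact: ler01.
by rewrite avoid_probS average_ge0// => y; rewrite mulr_ge0.
Qed.

Lemma avoid_prob_decr m x : avoid_prob m.+1 x <= avoid_prob m x.
Proof.
elim: m x => [|m IHm] x; rewrite avoid_probS; last first.
  by apply: ler_average => // y; rewrite ler_wpM2l.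
rewrite -[leRHS](average_cst T_lf T_infinite c_gt0 1 x).
apply: ler_average => // y.
by rewrite mulr1 indicE lern1 leq_b1.
Qed.

Definition escape_prob x : R := limn (avoid_prob ^~ x).

Lemma cvg_escape_prob x : avoid_prob m x @[m --> \oo] --> escape_prob x.
Proof.
apply: nonincreasing_is_cvgn.
  by apply/nonincreasing_seqP => m; exact: avoid_prob_decr.
by exists 0 => _ [m _ <-]; exact: avoid_prob_ge0.
Qed.

Lemma escape_prob_ge0 x : 0 <= escape_prob x.
Proof.
apply: limr_ge; first exact: cvg_escape_prob.
by apply: nearW => m; exact: avoid_prob_ge0.
Qed.

Lemma escape_prob_le1 x : escape_prob x <= 1.
Proof.
apply: (@nonincreasing_cvgn_ge _ (avoid_prob ^~ x) _ _ 0%N).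
  by apply/nonincreasing_seqP => m; exact: avoid_prob_decr.
exact: cvg_escape_prob.
Qed.

(** The escape probability with the value 0 at the root: the voltage of the
    network whose root is grounded. *)
Definition voltage x : R := \1_off_root x * escape_prob x.

Lemma escape_probE x : escape_prob x = average c voltage x.
Proof.
have := @cvg_escape_prob x; rewrite -(cvg_shiftS (avoid_prob ^~ x)) => /cvg_lim <-//.
apply/cvg_lim => //; apply: cvg_average => y.
by apply: cvgM; [exact: cvg_cst|exact: cvg_escape_prob].
Qed.

Lemma voltage_root : voltage (root T) = 0.
Proof. by rewrite /voltage indicE memNset ?mul0r//; apply. Qed.

Lemma voltageE x : x != root T -> voltage x = escape_prob x.
Proof.
by move=> x0; rewrite /voltage indicE mem_set ?mul1r//; apply/eqP.
Qed.

Lemma voltage_ge0 x : 0 <= voltage x.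
Proof. by rewrite mulr_ge0 ?escape_prob_ge0. Qed.

Lemma voltage_le1 x : voltage x <= 1.
Proof.
have [->|x0] := eqVneq x (root T); first by rewrite voltage_root ler01.
by rewrite voltageE ?escape_prob_le1.
Qed.

Definition current x : R := c (up_edge x) * (voltage x - voltage (parent x)).

Lemma current_le x : current x <= c (up_edge x).
Proof.
rewrite ler_piMr ?(ltW (c_gt0 _))// lerBlDr.
by rewrite (le_trans (voltage_le1 x))// lerDl voltage_ge0.
Qed.

Lemma sum_current x : \sum_(y <- children x) current y =
  (if x == root T then total_conductance c x * escape_prob x else current x).
Proof.
have := average_defect T_lf T_infinite c_gt0 voltage x.
rewrite -escape_probE sum_neighbours//.
rewrite [X in _ = _ + X](_ : _ = - \sum_(y <- children x) current y); last first.
  rewrite -sumrN; apply: eq_big_seq => y; rewrite mem_children//.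
  by move=> /andP[_ /eqP <-]; rewrite /current -[RHS]mulrN opprB.
case: eqVneq => [->|x0].
  by rewrite voltage_root sub0r add0r mulrN => /oppr_inj.
rewrite voltageE// subrr mulr0 fsetUC -voltageE// => /esym/eqP.
by rewrite subr_eq0 => /eqP <-.
Qed.

(** The escape probability is a current flowing from infinity to the root
    under a voltage at most 1, hence at most the capacity of any cutset. *)
Lemma escape_le_cut (pi : set {fset T}) : cutset pi ->
  ((total_conductance c (root T) * escape_prob (root T))%:E <=
   \esum_(e in pi) (c e)%:E)%E.
Proof.
have := sum_current (root T); rewrite eqxx => <-.
apply: flow_le_cut => // [e||x x0].
- exact: ltW.
- exact: current_le.
- by rewrite sum_current (negbTE x0).
Qed.

Lemma average_eq0 (f : T -> R) x y : (forall z, 0 <= f z) ->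
  average c f x = 0 -> adj x y -> f y = 0.
Proof.
move=> f0 /eqP; rewrite averageE// mulf_eq0 orbC invr_eq0.
rewrite gt_eqF ?total_conductance_gt0//= psumr_eq0; last first.
  by move=> z _; rewrite mulr_ge0// ltW.
move=> /allP + xy => /(_ y); rewrite mem_neighbours// xy => /(_ isT).
by rewrite mulf_eq0 gt_eqF//= => /eqP.
Qed.

(** The voltage is non-negative, so where its mean over the neighbours vanishes
    it vanishes at each of them; the zero spreads from the root. *)
Lemma no_escape : escape_prob (root T) = 0 -> forall x, escape_prob x = 0.
Proof.
move=> root0 x; have [p + <-] := adj_connected (root T) x.
move: (root0); elim: p {1 2 3}(root T) => [|z p IHp] y y0 //= /andP[yz].
apply: IHp; have [->|zr] := eqVneq z (root T); first exact: root0.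
rewrite -voltageE//; apply: average_eq0 yz; first exact: voltage_ge0.
by rewrite -escape_probE.
Qed.

Lemma cvg_late_avoid N : escape_prob (root T) = 0 -> forall x,
  visit_prob c (nseq N setT ++ nseq m off_root) x @[m --> \oo] --> (0 : R).
Proof.
move=> root0; elim: N => [|N IHN] x /=.
  by rewrite -(no_escape root0 x); exact: cvg_escape_prob.
rewrite -(average_cst T_lf T_infinite c_gt0 0 x); apply: cvg_average => y.
rewrite -[X in _ --> X](mul1r 0) indicT; apply: cvgM; first exact: cvg_cst.
exact: IHN.
Qed.

Context d (Omega : measurableType d) (P : probability Omega R).
Variable X : nat -> Omega -> T.
Hypothesis X_walk : random_walk P c X.

Lemma visits_late N m w : (forall n, (N < n)%N -> X n w <> root T) ->
  visits X 0 (nseq N setT ++ nseq m off_root) w.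
Proof.
have -> : (forall n, (N < n)%N -> X n w <> root T) =
          (forall n, (N + 0 < n)%N -> X n w <> root T) by rewrite addn0.
elim: N 0%N => [|N IHN] k late /=; last first.
  by split=> //; apply: IHN => n; rewrite addnS -addSn; apply: late.
elim: m k late => [//|m IHm] k late /=; split; first by apply: late.
by apply: IHm => n kn; apply: late; apply: ltnW.
Qed.

(** A walk that visits the root finitely often avoids it after some time [N].
    By the Markov property this has probability the mean of the escape
    probability at time [N], which is zero. *)
Lemma recurrent_of_no_escape : escape_prob (root T) = 0 -> recurrent P X.
Proof.
move=> root0.
pose late N : set Omega :=
  \bigcap_(n in [set n | (N < n)%N]) ~` (X n @^-1` [set root T]).
have m1 n : measurable (X n @^-1` [set root T]) by exact: (testable1 X_walk).
have mlate N : measurable (late N).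
  apply: bigcap_measurable => [|n _]; first by exists N.+1 => /=.
  exact: measurableC.
have late0 N : P (late N) = 0%E.
  apply/eqP; rewrite eq_le measure_ge0 andbT.
  pose Bs m := nseq N setT ++ nseq m off_root.
  have testBs m : {in Bs m, forall B, testable X B}.
    move=> B; rewrite mem_cat !mem_nseq => /orP[|] /andP[_ /eqP->].
      exact: testableT.
    by apply: testableC; exact: (testable1 X_walk).
  have le_late m : (P (late N) <= (visit_prob c (Bs m) (root T))%:E)%E.
    rewrite -(prob_visits0 T_lf T_infinite c_gt0 X_walk)//.
    apply: le_measure; rewrite ?inE//; first exact: measurable_visits.
    by move=> w wlate; apply: visits_late => n Nn; exact: wlate.
  have /fineK PE : P (late N) \is a fin_num by exact: fin_num_measure.
  rewrite -PE lee_fin.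
  apply: (cvgr_to_ge (cvg_late_avoid N root0 (root T))).
  by apply: nearW => m; rewrite -lee_fin PE; exact: le_late.
have ioE : root_infinitely_often X = ~` \bigcup_N late N.
  apply/seteqP; split=> w.
    move=> io [N _ wlate]; have [n Nn wn] := io N.+1; exact: wlate Nn wn.
  move=> /= wN N; apply: contrapT => noroot; apply: wN; exists N => // n Nn wn.
  by apply: noroot; exists n => //; exact: ltnW.
rewrite /recurrent ioE probability_setC; last exact: bigcup_measurable.
rewrite measure_negligible ?sube0//; first exact: bigcup_measurable.
apply: negligible_bigcup => N; apply/negligibleP; first exact: mlate.
exact: late0.
Qed.

End recurrence.

(** * Maximal flows as limits of minimal cuts *)

Section cuts_to_flow.
Context (R : realType) (T : rooted_tree).
Hypothesis T_lf : locally_finite T.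
Variable cap : T -> R.
Hypothesis cap_ge0 : forall x, 0 <= cap x.
Implicit Types x y z : T.

(** The cheapest set of vertices that separates [x] from its descendants
    [k.+1] generations below, found greedily: below each child [z] one either
    cuts at [z] or, if this is cheaper, optimally within the next [k]
    generations. *)
Fixpoint greedy_cut k x : seq T :=
  if k is k'.+1 then
    flatten [seq (if cap z <= \sum_(y <- greedy_cut k' z) cap y then [:: z]
                  else greedy_cut k' z) | z <- children x]
  else children x.

Definition cut_value k x : R := \sum_(y <- greedy_cut k x) cap y.

Definition flow_upto k x : R := Num.min (cap x) (cut_value k x).

Lemma cut_valueS k x : cut_value k.+1 x = \sum_(z <- children x) flow_upto k z.
Proof.
rewrite /cut_value big_flatten big_map; apply: eq_bigr => z _.
rewrite /flow_upto /cut_value minEle.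
by case: ifP => _ //; rewrite big_seq1.
Qed.

Lemma cut_value_ge0 k x : 0 <= cut_value k x.
Proof. by apply: sumr_ge0 => y _. Qed.

Lemma cut_value_decr k x : cut_value k.+1 x <= cut_value k x.
Proof.
elim: k x => [|k IHk] x; rewrite cut_valueS.
  by apply: ler_sum => z _; rewrite ge_min lexx.
rewrite cut_valueS; apply: ler_sum => z _.
by rewrite le_min !ge_min lexx IHk orbT.
Qed.

(** The limit of the maximal flows into [x] of the truncated trees.  Where the
    edge above [x] is the bottleneck, more can leave [x] than enters; the
    inequality between the two is what superharmonicity asks for. *)
Definition limit_flow x : R := limn (flow_upto ^~ x).

Lemma flow_upto_decr x : nonincreasing_seq (flow_upto ^~ x).
Proof.
apply/nonincreasing_seqP => k.
by rewrite le_min !ge_min lexx cut_value_decr orbT.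
Qed.

Lemma flow_upto_ge0 k x : 0 <= flow_upto k x.
Proof. by rewrite le_min cap_ge0 cut_value_ge0. Qed.

Lemma cvg_limit_flow x : flow_upto k x @[k --> \oo] --> limit_flow x.
Proof.
apply: nonincreasing_is_cvgn; first exact: flow_upto_decr.
by exists 0 => _ [k _ <-]; exact: flow_upto_ge0.
Qed.

Lemma limit_flow_le x : limit_flow x <= cap x.
Proof.
apply: limr_le; first exact: cvg_limit_flow.
by apply: nearW => k; rewrite ge_min lexx.
Qed.

(** The hard half of max-flow min-cut: the flow out of [x] is the limit of the
    values of cuts, hence at least the infimum over all cuts. *)
Lemma cvg_cut_value x :
  cut_value k x @[k --> \oo] --> \sum_(y <- children x) limit_flow y.
Proof.
rewrite -(cvg_shiftS (cut_value ^~ x)) /=.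
under eq_cvg do rewrite cut_valueS.
apply: cvg_big => [z|y _]; first exact: add_continuous.
exact: cvg_limit_flow.
Qed.

Lemma limit_flow_out x : limit_flow x <= \sum_(y <- children x) limit_flow y.
Proof.
apply: (ler_cvg_to (@cvg_limit_flow x) (@cvg_cut_value x)).
by apply: nearW => k; rewrite ge_min lexx orbT.
Qed.

Lemma greedy_cut_descendants k x y : y \in greedy_cut k x ->
  y != root T /\ descendants x y.
Proof.
elim: k x => [|k IHk] x /=.
  by rewrite mem_children// => /andP[-> /eqP yx]; split=> //; exists 1%N.
move=> /flattenP[s /mapP[z + ->]]; rewrite mem_children// => /andP[z0 /eqP zx].
case: ifP => _; first by rewrite inE => /eqP ->; split=> //; exists 1%N.
by move=> /IHk[y0 [j yz]]; split=> //; exists j.+1; rewrite iterS yz.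
Qed.

Lemma ray_descendants (r : nat -> T) z m : root_ray r ->
  descendants z (r m) -> z = r (height z).
Proof.
move=> rr [j rz]; have := height_iter_parent j (r m).
rewrite rz ray_height// => ->.
have [jm|mj] := leqP j m; first by rewrite -rz -[in LHS](subnK jm) ray_iter_parent.
have -> : (m - j = 0)%N by lia.
case: (rr) => -> _ _; apply: height_eq0; rewrite -rz height_iter_parent.
by rewrite ray_height//; lia.
Qed.

(** A ray meets a greedy cut exactly once, because only the part of the cut at
    or below the child that the ray visits can contain vertices of the ray. *)
Lemma greedy_cut_ray k n (r : nat -> T) : root_ray r ->
  exists m, forall m', (r m' \in greedy_cut k (r n)) = (m' == m).
Proof.
move=> rr; have rinj : injective r by case: rr.
have [rn0 rp] : r n.+1 != root T /\ parent (r n.+1) = r n by exact: ray_parent.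
elim: k n rn0 rp => [|k IHk] n rn0 rp /=.
  exists n.+1 => m'; rewrite mem_children//.
  apply/andP/eqP => [[r0 /eqP rm']|->]; last by rewrite rn0 rp.
  case: m' r0 rm' => [|m'] r0; first by case/negP: r0; case: (rr) => ->.
  by rewrite (ray_parent rr m').2 => /rinj ->.
set piece := fun z => if _ then _ else _.
have piece_mem m' : (r m' \in flatten [seq piece z | z <- children (r n)]) =
                    (r m' \in piece (r n.+1)).
  apply/flattenP/idP => [[_ /mapP[z + ->]]|rm']; last first.
    exists (piece (r n.+1)) => //; apply: map_f.
    by rewrite mem_children// rn0 rp eqxx.
  rewrite mem_children// => /andP[z0 /eqP zx] rm'.
  have zrm' : descendants z (r m').
    move: rm'; rewrite /piece; case: ifP => _.
      by rewrite inE => /eqP ->; exact: descendants_refl.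
    by move=> /greedy_cut_descendants[].
  have [_ hz] := parentP z0.
  by move: rm'; rewrite [z](ray_descendants rr zrm') hz zx ray_height.
have [rn0' rp'] := ray_parent rr n.+1.
have [m mP] := IHk n.+1 rn0' rp'.
rewrite /piece in piece_mem *.
case: ifP piece_mem => _ piece_mem; last by exists m => m'; rewrite piece_mem.
exists n.+1 => m'; rewrite piece_mem inE.
by apply/eqP/eqP => [/rinj|->].
Qed.

Definition greedy_cutset k : set {fset T} :=
  (@up_edge T) @` [set` greedy_cut k (root T)].

Lemma cutset_greedy k : cutset (greedy_cutset k).
Proof.
split=> [_ [y /= /greedy_cut_descendants[y0 _] <-]|r rr].
  exact: up_edge_edges.
have r0 : r 0%N = root T by case: rr.
have [m mP] := @greedy_cut_ray k 0 r rr; rewrite r0 in mP.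
have mcut : r m \in greedy_cut k (root T) by rewrite mP.
have [rm0 _] := greedy_cut_descendants mcut.
have upE j : up_edge (r j.+1) = [fset r j; r j.+1]%fset.
  by rewrite /up_edge (ray_parent rr j).2.
exists (up_edge (r m)); split.
  split; first by exists (r m).
  case: m rm0 {mP mcut} => [|m] rm0; first by case/eqP: rm0.
  by exists m.
move=> _ [[y ycut <-] [j _]]; rewrite -upE => /up_edge_inj.
have [y0 _] := greedy_cut_descendants ycut.
rewrite (ray_parent rr j).1 y0 => /(_ isT isT) jy; rewrite -jy.
by move: ycut; rewrite /= -jy mP => /eqP ->.
Qed.

Lemma sum_undup_le (I : eqType) (s : seq I) (F : I -> R) :
  (forall i, 0 <= F i) -> \sum_(i <- undup s) F i <= \sum_(i <- s) F i.
Proof.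
move=> F0; elim: s => [|i s IHs] //=; rewrite big_cons; case: ifP => _.
  by rewrite (le_trans IHs)// lerDr.
by rewrite big_cons lerD2l.
Qed.

Lemma esum_greedy_cutset (w : {fset T} -> R) k :
  (forall y, w (up_edge y) = cap y) ->
  (\esum_(e in greedy_cutset k) (w e)%:E <= (cut_value k (root T))%:E)%E.
Proof.
move=> wE; rewrite esum_image; last first.
  move=> y z; rewrite !inE /= => /greedy_cut_descendants[y0 _].
  by move=> /greedy_cut_descendants[z0 _]; exact: up_edge_inj.
rewrite esum_fset//; last by move=> y _; rewrite lee_fin wE.
rewrite [[set` _]](_ : _ = [set` undup (greedy_cut k (root T))]); last first.
  by apply/seteqP; split=> y /=; rewrite mem_undup.
rewrite -fsbig_seq ?undup_uniq// sumEFin lee_fin.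
by under eq_bigr do rewrite wE; exact: sum_undup_le.
Qed.

End cuts_to_flow.

(** * Transience *)

Section transience.
Context (R : realType) (T : rooted_tree).
Hypothesis T_lf : locally_finite T.
Hypothesis T_infinite : infinite_set [set: T].
Variable c : {fset T} -> R.
Hypothesis c_gt0 : forall e, 0 < c e.
Implicit Types x y : T.

Section potential.
Variable theta : T -> R.

(** The voltage drop between the root and [x] of the flow [theta]. *)
Definition drop x : R :=
  \sum_(j < height x)
    theta (iter j (@parent T) x) / c (up_edge (iter j (@parent T) x)).

Lemma drop_root : drop (root T) = 0.
Proof. by rewrite /drop height_root big_ord0. Qed.

Lemma drop_parent x : x != root T ->
  drop x = theta x / c (up_edge x) + drop (parent x).
Proof.
move=> /parentP[_ hx]; rewrite /drop hx big_ord_recl; congr (_ + _).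
by apply: eq_bigr => j _; rewrite /= -iterSr.
Qed.

(** Minus the drop is a voltage under which the current in each edge is
    [theta]. *)
Lemma drop_defect x : total_conductance c x * (average c drop x - drop x) =
  \sum_(y <- children x) theta y - (if x == root T then 0 else theta x).
Proof.
rewrite -opprB mulrN average_defect// sum_neighbours// opprD addrC; congr (_ + _).
  rewrite -sumrN; apply: eq_big_seq => y; rewrite mem_children//.
  move=> /andP[y0 /eqP <-]; rewrite (drop_parent y0) -mulrN opprB addrK.
  by rewrite mulrC divfK// gt_eqF.
congr (- _); case: eqVneq => // x0.
by rewrite (drop_parent x0) addrK mulrC fsetUC divfK// gt_eqF.
Qed.

Lemma drop_le (rho : nat -> R) x :
  (forall y, theta y / c (up_edge y) <= rho (height y)) ->
  drop x <= \sum_(n < height x) rho n.+1.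
Proof.
move=> theta_rho; have [n] := ubnP (height x); elim: n x => // n IHn x.
have [->|x0] := eqVneq x (root T); first by rewrite drop_root height_root big_ord0.
have [_ hx] := parentP x0; rewrite drop_parent// hx ltnS => /IHn IHx.
by rewrite big_ord_recr/= addrC lerD// -hx.
Qed.

End potential.

(** The probability to be at the root at time [k], not necessarily for the
    first time. *)
Fixpoint return_prob k x : R :=
  if k is k'.+1 then average c (return_prob k') x else \1_[set root T] x.

Lemma visit_prob_return k :
  visit_prob c (nseq k setT ++ [:: [set root T]]) = return_prob k.+1.
Proof.
elim: k => [|k IHk]; apply/funext => x /=; apply: eq_bigr => y _.
  by rewrite mulr1.
by rewrite indicT mul1r -/(visit_prob _ _) IHk.
Qed.

(** Along the walk the mean of [v] stays non-negative and loses at least [eps]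
    times the probability to be at the root, so its initial value bounds the
    expected number of visits to the root. *)
Lemma sum_return_prob (v : T -> R) (eps : R) :
  (forall x, 0 <= v x) ->
  (forall x, eps * \1_[set root T] x + average c v x <= v x) ->
  forall n x, eps * \sum_(k < n) return_prob k x <= v x.
Proof.
move=> v0 vdrop; elim=> [|n IHn] x; first by rewrite big_ord0 mulr0.
apply: le_trans (vdrop x); rewrite big_ord_recl mulrDr lerD2l.
rewrite -average_sum.
rewrite -[leLHS](_ :
  average c (fun y => eps * \sum_(k < n) return_prob k y) x = _).
  exact: ler_average.
by rewrite /average mulr_sumr; apply: eq_bigr => y _; rewrite mulrCA.
Qed.

Context d (Omega : measurableType d) (P : probability Omega R).
Variable X : nat -> Omega -> T.
Hypothesis X_walk : random_walk P c X.

Lemma visits_return n k :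
  visits X n (nseq k setT ++ [:: [set root T]]) =
  X (n + k).+1 @^-1` [set root T].
Proof.
elim: k n => [|k IHk] n /=; first by rewrite setIT addn0.
by rewrite IHk preimage_setT setTI addSnnS.
Qed.

Lemma prob_return k :
  P (X k.+1 @^-1` [set root T]) = (return_prob k.+1 (root T))%:E.
Proof.
rewrite -visit_prob_return -(prob_visits0 T_lf T_infinite c_gt0 X_walk).
  by rewrite visits_return.
move=> B; rewrite mem_cat mem_nseq inE => /orP[/andP[_]|] /eqP ->.
  exact: testableT.
exact: (testable1 X_walk).
Qed.

Lemma transient_of_bounded_returns (B : R) :
  (forall n, \sum_(k < n) return_prob k (root T) <= B) -> transient P X.
Proof.
move=> retB.
pose F k := X k.+1 @^-1` [set root T].
have mF k : measurable (F k) by exact: (testable1 X_walk).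
have ioE : root_infinitely_often X = lim_sup_set F.
  apply/seteqP; split=> w io n.
    by move=> _; have [[|m] // nm rm] := io n.+1; exists m.
  by have [m /= nm Fm] := io n I; exists m.+1 => //; exact: ltnW.
rewrite /transient ioE.
apply: lim_sup_set_cvg0 => //; apply: (@le_lt_trans _ _ B%:E); last exact: ltry.
apply: lime_le; first by apply: is_cvg_nneseries => k _ _; exact: measure_ge0.
apply: nearW => n; rewrite big_mkord.
rewrite (eq_bigr (fun k : 'I_n => (return_prob k.+1 (root T))%:E)); last first.
  by move=> k _; exact: prob_return.
rewrite sumEFin lee_fin; apply: le_trans (retB n.+1).
by rewrite big_ord_recl lerDr.
Qed.

(** A flow whose voltage drops along rays are bounded makes the walk
    transient: the bound minus the drop is a non-negative superharmonic
    function, with a strict loss at the root. *)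
Lemma transient_of_flow (theta : T -> R) (rho : nat -> R) (B : R) :
  (forall x, x != root T -> theta x <= \sum_(y <- children x) theta y) ->
  0 < \sum_(y <- children (root T)) theta y ->
  (forall y, theta y / c (up_edge y) <= rho (height y)) ->
  (forall n, \sum_(k < n) rho k.+1 <= B) ->
  transient P X.
Proof.
move=> theta_out theta_root theta_rho rhoB.
pose v x := B - drop theta x.
have v0 x : 0 <= v x by rewrite subr_ge0 (le_trans (drop_le _ theta_rho)).
have tot0 x : 0 < total_conductance c x by exact: total_conductance_gt0.
pose eps := (\sum_(y <- children (root T)) theta y) / total_conductance c (root T).
have eps0 : 0 < eps by rewrite divr_gt0.
have average_v x : average c v x = B - average c (drop theta) x.
  rewrite -[in RHS](average_cst T_lf T_infinite c_gt0 B x) -sumrB.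
  by apply: eq_bigr => y _; rewrite -mulrBr.
have vdrop x : eps * \1_[set root T] x + average c v x <= v x.
  rewrite average_v /v addrCA lerD2l lerBlDr [leRHS]addrC.
  rewrite -(ler_pM2l (tot0 x)) drop_defect.
  have [->|x0] := eqVneq x (root T).
    rewrite indicE mem_set// mulr1 subr0 mulrC divfK// gt_eqF//.
  rewrite indicE memNset ?mulr0 ?subr_ge0 ?theta_out//; exact/eqP.
apply: (@transient_of_bounded_returns (v (root T) / eps)) => n.
by rewrite ler_pdivlMr// mulrC; exact: sum_return_prob.
Qed.

End transience.

(** * Summability of ratios of stretched exponentials *)

(** With [t := n `^ a] and [M := 1 + 2 / a], the logarithm of the product is
    [t - t * n `^ (b - a) + 2 * ln n <= t * (M - n `^ (b - a))], because
    [2 * ln n = 2 / a * ln t <= 2 / a * t].  This can be positive only for [n]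
    below [M `^ (b - a)^-1]. *)
Lemma stretched_exp_ratio (R : realType) (a b : R) : 0 < a -> a < b ->
  exists2 K : R, 0 < K & forall n, (0 < n)%N ->
    expR (n%:R `^ a - n%:R `^ b) * n%:R ^+ 2 <= K.
Proof.
move=> a0 ab; pose M := 1 + 2 / a; pose N := M `^ (b - a)^-1.
have ba0 : 0 < b - a by rewrite subr_gt0.
have M0 : 0 < M by rewrite addr_gt0// divr_gt0.
exists (expR (M * N `^ a)) => [|n n0]; first exact: expR_gt0.
have nR0 : 0 < n%:R :> R by rewrite ltr0n.
have -> : n%:R ^+ 2 = expR (2 * ln n%:R) :> R.
  by rewrite expRM_natl lnK.
rewrite -expRD ler_expR.
set t := n%:R `^ a; have t0 : 0 < t by exact: powR_gt0.
have -> : n%:R `^ b = t * n%:R `^ (b - a).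
  by rewrite -powRD ?(gt_eqF nR0) ?implybT// addrC subrK.
have ln_le : 2 * ln n%:R <= 2 / a * t.
  rewrite -mulrA ler_pM2l// mulrC ler_pdivlMr// mulrC -ln_powR.
  exact/ltW/ln_sublinear.
have : t - t * n%:R `^ (b - a) + 2 * ln n%:R <= t * (M - n%:R `^ (b - a)).
  by rewrite mulrBr /M; lra.
move=> /le_trans; apply.
have [Mn|nM] := leP M (n%:R `^ (b - a)).
  apply: (@le_trans _ _ 0); first by rewrite pmulr_rle0// subr_le0.
  by rewrite mulr_ge0 ?powR_ge0// ltW.
apply: (@le_trans _ _ (t * M)); first by rewrite ler_pM2l// gerBl powR_ge0.
rewrite mulrC ler_pM2l// ge0_ler_powR ?nnegrE ?powR_ge0 ?ler0n ?(ltW a0)//.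
have -> : n%:R = (n%:R `^ (b - a)) `^ (b - a)^-1 :> R.
  by rewrite -powRrM mulfV ?gt_eqF// powRr1// ltW.
by rewrite ge0_ler_powR ?nnegrE ?powR_ge0 ?invr_ge0 ?(ltW ba0) ?(ltW M0) ?(ltW nM).
Qed.

Lemma stretched_exp_summable (R : realType) (a b : R) : 0 < a -> a < b ->
  exists B : R, forall N,
    \sum_(k < N) expR (k.+1%:R `^ a - k.+1%:R `^ b) <= B.
Proof.
move=> a0 ab; have [K K0 KP] := stretched_exp_ratio a0 ab.
exists (2 * K) => N.
apply: (@le_trans _ _ (2 * K * (1 - N.+1%:R^-1))); last first.
  by rewrite ler_piMr ?mulr_ge0 ?(ltW K0)// gerBl invr_ge0.
elim: N => [|N IHN]; first by rewrite big_ord0 invr1 subrr mulr0.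
rewrite big_ord_recr/=; have := KP N.+1 isT; set r := expR _.
have : 1 <= N.+1%:R :> R by rewrite ler1n.
rewrite -(natr1 N.+1); move: IHN; set n : R := N.+1%:R; clearbody r n => IHN n1.
rewrite -ler_pdivlMr; last by rewrite exprn_gt0//; lra.
(* the bound [K / n ^ 2] is at most the increment of a telescoping sum *)
have inv_le : K / n ^+ 2 <= 2 * K * (n^-1 - (n + 1)^-1).
  have -> : 2 * K * (n^-1 - (n + 1)^-1) = K / n ^+ 2 * (2 * n / (n + 1)).
    by field; apply/andP; split; lra.
  rewrite ler_peMr//; first by rewrite divr_ge0 ?exprn_ge0 ?(ltW K0)//; lra.
  by rewrite ler_pdivlMr; lra.
by move: inv_le; rewrite !mulrBr => ? ?; move: IHN; rewrite mulrBr; lra.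
Qed.

(** * Recurrence or transience according to the branching number *)

Theorem theorem3p2 (R : realType) (T : rooted_tree)
    (T_locally_finite : locally_finite T)
    (T_infinite : infinite_set [set: T])
    (T_intermediate : intermediate_growth R T)
    (lambda : R) (lambda_gt0 : 0 < lambda)
    (d : measure_display) (Omega : measurableType d)
    (P : probability Omega R) (X : nat -> Omega -> T)
    (X_walk : random_walk P (@conductance R T lambda) X) :
  ((IBN R T < lambda%:E)%E -> recurrent P X) /\
  ((lambda%:E < IBN R T)%E -> transient P X).
Proof.
have c_gt0 (l : R) (e : {fset T}) : 0 < conductance l e by exact: expR_gt0.
split=> [IBN_lt|].
  apply: (recurrent_of_no_escape T_locally_finite T_infinite (c_gt0 lambda) X_walk).
  have inf_le0 : (cutset_inf T lambda <= 0)%E.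
    rewrite leNgt; apply/negP => inf_gt0; move: IBN_lt.
    rewrite ltNge => /negP; apply; rewrite le_max; apply/orP; right.
    by apply: ereal_sup_ubound; exists lambda.
  apply/eqP; rewrite eq_le escape_prob_ge0// andbT.
  rewrite -(pmulr_rle0 _ (total_conductance_gt0 T_locally_finite T_infinite
    (c_gt0 lambda) (root T))) -lee_fin.
  apply: le_trans inf_le0; apply: le_ereal_inf_tmp => _ [pi cut_pi <-].
  exact: escape_le_cut.
rewrite lt_max => /orP[|]; first by rewrite lte_fin ltNge (ltW lambda_gt0).
move=> /ereal_sup_gt[_ [mu [mu_gt0 inf_gt0] <-]]; rewrite lte_fin => lambda_mu.
pose cap (x : T) := conductance mu (up_edge x).
have cap_ge0 x : 0 <= cap x by exact/ltW/c_gt0.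
have [B rhoB] := stretched_exp_summable lambda_gt0 lambda_mu.
apply: (transient_of_flow T_locally_finite T_infinite (c_gt0 lambda) X_walk
  (theta := limit_flow cap) (rho := fun n => expR (n%:R `^ lambda - n%:R `^ mu)))
  rhoB => [x _||y].
- exact: limit_flow_out.
- have inf_le k : (cutset_inf T mu <= (cut_value cap k (root T))%:E)%E.
    apply: le_trans (esum_greedy_cutset T_locally_finite cap_ge0 k (fun=> erefl)).
    apply: ereal_inf_lbound; exists (greedy_cutset cap k) => //.
    exact: cutset_greedy.
  have inf_fin : cutset_inf T mu \is a fin_num.
    by rewrite ge0_fin_numE ?(ltW inf_gt0)// (le_lt_trans (inf_le 0%N)) ?ltry.
  apply: (@lt_le_trans _ _ (fine (cutset_inf T mu))).
    by rewrite fine_gt0// inf_gt0 ltey_eq inf_fin.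
  apply: (cvgr_to_ge (cvg_cut_value cap_ge0 (x := root T))).
  by apply: nearW => k; rewrite -lee_fin fineK.
- rewrite ler_pdivrMr// -expRD edge_height_up.
  apply: le_trans (limit_flow_le cap_ge0 y) _.
  by rewrite /cap /conductance edge_height_up ler_expR; lra.
Qed.
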